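(* For each $n\ge 3$ there is a tight irreducible subcube partition of $\{0,1\}^n$ whose weight vector is $(1,n,n-3,1,0,\dots,0)$.
   Context: Subcubes of $\{0,1\}^n$ are identified with words in $\{0,1,*\}^n$. A subcube partition of length $n$ is a partition of $\{0,1\}^n$ into subcubes. It is irreducible if no subset $G$ with $1<|G|<|F|$ has a union that is a subcube; tight if every coordinate $i$ has some subcube $s$ with $s_i\ne*$. The weight of a subcube is the number of $1$s in its word. The weight vector of $F$ is $(w_0,\dots,w_n)$ where $w_h$ is the number of subcubes of $F$ of weight $h$. *)

(* Defs.v *)
From mathcomp Require Import all_boot.

Set Implicit Arguments.
Unset Strict Implicit.
Unset Printing Implicit Defensive.

Definition point (n : nat) := {ffun 'I_n -> bool}.

(* [None] is the star, [Some b] the fixed bit [b]. *)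
Definition word (n : nat) := {ffun 'I_n -> option bool}.

Definition cube (n : nat) (s : word n) : {set point n} :=
  [set x : point n | [forall i, (s i == None) || (s i == Some (x i))]].

(* Words and subcubes may be identified: families of subcubes are sets of
   words below. *)
Lemma cube_inj (n : nat) : injective (@cube n).
Proof.
move=> s t eq_st; apply/ffunP => i.
have in_cube (u : word n) b : u i != Some (~~ b) ->
    [ffun j => if j == i then b else odflt false (u j)] \in cube u.
  move=> ui; rewrite inE; apply/forallP => j; rewrite ffunE.
  case: (j =P i) => [->|_]; first by case: (u i) ui => [[]|] //; case: b.
  by case: (u j) => //= c; rewrite eqxx.
have at_i (u v : word n) b : cube u = cube v -> u i != Some (~~ b) ->
    v i != Some (~~ b).
  move=> uv /in_cube; rewrite uv inE => /forallP/(_ i).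
  by rewrite ffunE eqxx => /orP[] /eqP ->; case: b.
have eq_i b : (s i != Some b) = (t i != Some b).
  by rewrite -[b]negbK; apply/idP/idP; apply: at_i.
by have := eq_i true; have := eq_i false; case: (s i) (t i) => [[]|] [[]|].
Qed.

Definition subcube_partition (n : nat) (F : {set word n}) : Prop :=
  partition [set cube s | s in F] [set: point n].

Definition irreducible (n : nat) (F : {set word n}) : Prop :=
  forall G : {set word n}, G \subset F -> 1 < #|G| < #|F| ->
  ~ exists s : word n, \bigcup_(t in G) cube t = cube s.

Definition tight (n : nat) (F : {set word n}) : Prop :=
  forall i : 'I_n, exists2 s : word n, s \in F & s i != None.

Definition weight (n : nat) (s : word n) : nat :=
  #|[set i | s i == Some true]|.

Definition weight_vector (n : nat) (F : {set word n}) : n.+1.-tuple nat :=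
  [tuple #|[set s in F | weight s == h]| | h < n.+1].

(* Main.v *)
(** Write a point of [{0,1}^(m+3)] as [(x, y, u)] with [u] of length [m+1], and
let [j <= m+1] be the number of leading zeros of [u].  The partition consists
of the subcube [L : (x, y) = (0, 1)] and, for each [j], of two subcubes in which
[u] starts with [0^j 1] and is free afterwards: [(x, y)] is [1*] or [00] when
[j <> m], and [11] or [*0] when [j = m] ([u = 0] when [j = m+1]).

For irreducibility, a subcube [S] that is a union of cells is closed under
mixing the coordinates of two of its points and under moving inside a cell.
If [S] meets two cells with the same [j], mixing their points gives a point of
[L].  If it meets cells with [j < j'], the free part of [u] in the first and the
zero at position [j] in the second give a point with [u = 0^m 1] and, after
a suitable choice of [y], with [y = 0]; its cell frees [x], which again leads to
[L].  Finally, [L] together with any other cell generates everything. *)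
Require Import Defs.
From mathcomp Require Import all_boot zify.

(** * Subcubes, and partitions into subcubes given by a labelling of the points *)

Lemma cube_neq0 (n : nat) (s : word n) : exists p, p \in cube s.
Proof.
exists [ffun i => odflt false (s i)]; rewrite inE; apply/forallP => i.
by rewrite ffunE; case: (s i) => //= b; rewrite eqxx.
Qed.

Lemma cube_mix (n : nat) (s : word n) (p q r : point n) :
    p \in cube s -> q \in cube s -> (forall i, r i = p i \/ r i = q i) ->
  r \in cube s.
Proof.
rewrite !inE => /forallP ps /forallP qs pqr; apply/forallP => i.
by case: (pqr i) => ->.
Qed.

Section LabelledPartition.
Variables (n : nat) (I : finType) (w : I -> word n) (lab : point n -> I).
Hypothesis in_cell : forall p i, (p \in cube (w i)) = (lab p == i).

Lemma cell_inj : injective w.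
Proof.
move=> i j wij; have [p pi] := cube_neq0 _ (w i).
have := pi; rewrite {1}wij !in_cell => /eqP <-.
by move: pi; rewrite in_cell => /eqP.
Qed.

Lemma cells_partition : subcube_partition (w @: I).
Proof.
apply/and3P; split.
- apply/eqP/setP => p; rewrite [RHS]inE; apply/bigcupP.
  exists (cube (w (lab p))); last by rewrite in_cell.
  by rewrite !imset_f.
- apply/trivIsetP => B C /imsetP[s /imsetP[i _ ->] ->].
  move=> /imsetP[t /imsetP[j _ ->] ->] neq; apply/pred0P => p /=.
  apply/negbTE; apply: contraNN neq; rewrite !in_cell.
  by move=> /andP[/eqP <- /eqP <-].
- apply/negP => /imsetP[s _ s0]; have [p] := cube_neq0 _ s.
  by rewrite -s0 inE.
Qed.

(** A subcube that is the union of a subfamily [G] with two or more members is a union of label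
    classes and meets two of them. The hypothesis makes it the whole space, so [G] contains every
    cell. *)
Lemma cells_irreducible :
    (forall s, (forall p q, lab p = lab q -> p \in cube s -> q \in cube s) ->
       forall p q, p \in cube s -> q \in cube s -> lab p <> lab q ->
       forall r, r \in cube s) ->
  irreducible (w @: I).
Proof.
move=> full G sGF /andP[G1 GF] [s Gs].
have inG i p : w i \in G -> lab p = i -> p \in cube s.
  by move=> Gi pi; rewrite -Gs; apply/bigcupP; exists (w i); rewrite ?in_cell ?pi.
have outG p : p \in cube s -> w (lab p) \in G.
  rewrite -Gs => /bigcupP[t Gt]; have /imsetP[i _ ti] := subsetP sGF t Gt.
  by rewrite ti in_cell => /eqP ->; rewrite -ti.
have /card_gt1P[t [t' [Gt Gt' tt']]] := G1.
have /imsetP[i _ ti] := subsetP sGF t Gt.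
have /imsetP[j _ tj] := subsetP sGF t' Gt'.
have [p] := cube_neq0 _ (w i); rewrite in_cell => /eqP pi.
have [q] := cube_neq0 _ (w j); rewrite in_cell => /eqP qj.
have sT : forall r, r \in cube s.
  apply: (full s _ p q).
  - by move=> p1 q1 e /outG; rewrite e => /inG; apply.
  - by apply: inG pi; rewrite -ti.
  - by apply: inG qj; rewrite -tj.
  - by rewrite pi qj => ij; rewrite ti tj ij eqxx in tt'.
have : w @: I \subset G.
  apply/subsetP => _ /imsetP[k _ ->]; have [r] := cube_neq0 _ (w k).
  by rewrite in_cell => /eqP <-; apply: outG.
by move/subset_leq_card; rewrite leqNgt GF.
Qed.

Lemma card_cells_weight (h : nat) :
  #|[set s in w @: I | weight s == h]| = \sum_i (weight (w i) == h).
Proof.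
rewrite -big_mkcond /= sum1dep_card -(card_imset _ cell_inj).
apply: eq_card => s; apply/idP/imsetP.
  rewrite inE => /andP[/imsetP[i _ ->] hi]; exists i => //; by rewrite inE.
by case=> i; rewrite !inE => hi ->; rewrite imset_f.
Qed.

End LabelledPartition.

(** * Leading zeros and the cells in coordinates *)

Section Construction.
Variable m : nat.

(* Only the values [v 0, ..., v m] matter; [lead v = m.+1] when they all vanish. *)
Definition lead (v : nat -> bool) : nat := find v (iota 0 m.+1).

Lemma leadP (v : nat -> bool) (j : nat) :
  reflect [/\ j <= m.+1, forall k, k < j -> v k = false & j <= m -> v j]
          (lead v == j).
Proof.
have lead_le : lead v <= m.+1 by rewrite -[m.+1](size_iota 0) find_size.
apply: (iffP eqP) => [<-|[jm vlt vj]]; rewrite /lead.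
  split=> // [k kj|le_m].
    by have := before_find 0 kj; rewrite nth_iota // (leq_trans kj).
  have hv : has v (iota 0 m.+1) by rewrite has_find size_iota.
  by have := nth_find 0 hv; rewrite nth_iota.
have [jm'|jm'] := leqP j m; last first.
  have -> : j = m.+1 by apply/eqP; rewrite eqn_leq jm.
  rewrite -[RHS](size_iota 0); apply: hasNfind; apply/hasPn => k.
  by rewrite mem_iota /= => km; rewrite vlt // (leq_trans km).
have -> : iota 0 m.+1 = iota 0 j ++ j :: iota j.+1 (m - j).
  by rewrite -{1}(subnKC jm') -addnS iotaD.
rewrite find_cat ifF /= ?vj // ?addn0 ?size_iota //.
by apply/hasP => -[k]; rewrite mem_iota /= => /vlt ->.
Qed.

(* The cell of [(x, y, v)]: [None] stands for [L], [Some (j, b)] for the cell with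
   [j] leading zeros whose fixed bit (of [y] if [j = m], of [x] otherwise) is [b]. *)
Definition cell (x y : bool) (v : nat -> bool) : option (nat * bool) :=
  if ~~ x && y then None else Some (lead v, if lead v == m then y else x).

(** * Sets closed under mixing and under moving inside a cell *)

Section Merge.
Variable T : bool -> bool -> (nat -> bool) -> Prop.
Hypothesis T_mix : forall x y v x' y' v' x'' y'' v'',
  T x y v -> T x' y' v' -> x'' = x \/ x'' = x' -> y'' = y \/ y'' = y' ->
  (forall k, v'' k = v k \/ v'' k = v' k) -> T x'' y'' v''.
Hypothesis T_cell : forall x y v x' y' v',
  cell x y v = cell x' y' v' -> T x y v -> T x' y' v'.

(* Throughout, [T x y v] means that the point [(x, y, v)] lies in [S]. *)
Lemma merge_None_x (v : nat -> bool) (y : bool) (v' : nat -> bool) :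
  T false true v -> T true y v' -> forall x y v, T x y v.
Proof.
move=> TL Tx a b c.
have TL' c' : T false true c' by apply: T_cell TL.
(* At [u = 0] the number of leading zeros is [m.+1], not [m], so the cell 1* frees [y] and gives
   [(1, 0, 0)]. Mixing this with [(0, 1, c)] yields every [(a, b, c)]. *)
have T0 : T true true (fun=> false).
  by apply: (T_mix _ _ _ _ _ _ _ _ _ Tx (TL' (fun=> false))); auto.
have lead0 : lead (fun=> false) = m.+1.
  by apply/eqP/leadP; split; rewrite // ltnn.
have T1 : T true false (fun=> false).
  by apply: T_cell T0; rewrite /cell lead0 /= gtn_eqF.
by apply: (T_mix _ _ _ _ _ _ _ _ _ T1 (TL' c)); auto; [case: a|case: b]; auto.
Qed.

Lemma lead_last : lead (eq_op^~ m) = m.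
Proof. by apply/eqP/leadP; split=> [||_] //= k km; rewrite ltn_eqF. Qed.

(** Only [(x, y) = (0, 0)] is new. As [u] is free in [L], mixing gives [(0, 0)] with [u = 0^m 1],
    and its cell *0 allows [x = 1]. *)
Lemma merge_None (v : nat -> bool) (x y : bool) (v' : nat -> bool) :
  T false true v -> T x y v' -> ~~ (~~ x && y) -> forall x y v, T x y v.
Proof.
move=> TL; case: x => [Tx _|]; first exact: merge_None_x TL Tx.
case: y => // Tq _.
have TL' : T false true (eq_op^~ m) by apply: T_cell TL.
apply: (merge_None_x _ false (eq_op^~ m) TL).
apply: (T_cell false false (eq_op^~ m)); first by rewrite /cell lead_last eqxx.
by apply: (T_mix _ _ _ _ _ _ _ _ _ TL' Tq); auto.
Qed.

(** The cell *0 of the first point contains [(0, 0, v)] and [(1, 0, v)]. Taking [y = 1] from the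
    second point turns the former into a point of [L]. *)
Lemma merge_last (x x' : bool) (v v' : nat -> bool) :
  lead v = m -> T x false v -> T x' true v' -> forall x y v, T x y v.
Proof.
move=> vm Tv Tv'.
have T0 b : T b false v.
  by apply: T_cell Tv; rewrite /cell vm eqxx !andbF.
have TL : T false true v by apply: (T_mix _ _ _ _ _ _ _ _ _ (T0 false) Tv'); auto.
exact: merge_None TL (T0 true) isT.
Qed.

Lemma merge_lead (x y x' y' : bool) (v v' : nat -> bool) :
    T x y v -> T x' y' v' -> ~~ (~~ x && y) -> ~~ (~~ x' && y') ->
    lead v < lead v' -> forall x y v, T x y v.
Proof.
move=> Tp Tq p0 q0 ltj.
have [j'm v'lt _] := leadP _ _ (eqxx (lead v')).
have jm : lead v <= m by rewrite -ltnS (leq_trans ltj).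
(* Both kinds of cell with [j <> m], 1* and 00, allow [y = 0]. *)
have y0 a b c : T a b c -> ~~ (~~ a && b) -> lead c != m ->
    exists a', T a' false c.
  case: b; case: a => // Tc _ cm; [exists true|by exists true|by exists false].
  by apply: T_cell Tc; rewrite /cell (negbTE cm).
have [a Ta] : exists a, T a false (eq_op^~ m).
  (* In the cell of [v]; taking the bit [lead v] from [v'] leaves only bit [m]. *)
  pose c k := (k == lead v) || (k == m).
  have cj : lead c = lead v.
    apply/eqP/leadP; split=> [|k kj|]; rewrite /c ?eqxx // ?(leq_trans jm) //.
    by rewrite !ltn_eqF // (leq_trans kj).
  have Tc : T x y c by apply: T_cell Tp; rewrite /cell cj.
  have mixm a b a' b' : T a b c -> T a' b' v' ->
      forall a'' b'', a'' = a \/ a'' = a' -> b'' = b \/ b'' = b' ->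
      T a'' b'' (eq_op^~ m).
    move=> T1 T2 a'' b'' ha hb; apply: (T_mix _ _ _ _ _ _ _ _ _ T1 T2) => // k.
    rewrite /c; have [->|_] := eqVneq k (lead v); last by left.
    by have [_|_] := eqVneq (lead v) m; [left|right; rewrite v'lt].
  (* The leading-zero counts differ, so one of the points has a count other than [m]; that point
     supplies [y = 0]. *)
  have [jm'|jm'] := eqVneq (lead v) m.
    have [|a' Ta'] := y0 _ _ _ Tq q0; first by rewrite -jm' gtn_eqF.
    by exists a'; apply: mixm Tc Ta' _ _ _ _; auto.
  have [|a' Ta'] := y0 _ _ _ Tc p0; first by rewrite cj.
  by exists a'; apply: mixm Ta' Tq _ _ _ _; auto.
have Tm b : T b false (eq_op^~ m).
  by apply: T_cell Ta; rewrite /cell lead_last eqxx !andbF.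
(* A point with count other than [m], once given [x = 1], lies in a cell 1* and so allows [y = 1],
   as [merge_last] requires. *)
have [z [b [c [Tc cm]]]] : exists a b c, T a b c /\ lead c != m.
  have [jm'|jm'] := eqVneq (lead v) m.
    by exists x', y', v'; rewrite -jm' gtn_eqF.
  by exists x, y, v.
have Tt : T true b c by apply: (T_mix _ _ _ _ _ _ _ _ _ (Tm true) Tc); auto.
have Tt' : T true true c by apply: T_cell Tt; rewrite /cell (negbTE cm).
exact: merge_last lead_last (Tm true) Tt'.
Qed.

Lemma merge_cells (x y x' y' : bool) (v v' : nat -> bool) :
  T x y v -> T x' y' v' -> cell x y v <> cell x' y' v' -> forall x y v, T x y v.
Proof.
move=> Tp Tq.
have [pN|pN] := boolP (~~ x && y).
  have [qN|qN] := boolP (~~ x' && y'); first by rewrite /cell pN qN.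
  by case: x y pN Tp => -[] // _ Tp _; apply: merge_None Tp Tq qN.
have [qN|qN] := boolP (~~ x' && y').
  by case: x' y' qN Tq => -[] // _ Tq _; apply: merge_None Tq Tp pN.
have [ltj|ltj|eqj] := ltngtP (lead v) (lead v').
- by move=> _; apply: merge_lead Tp Tq pN qN ltj.
- by move=> _; apply: merge_lead Tq Tp qN pN ltj.
rewrite /cell (negbTE pN) (negbTE qN) -eqj => neq.
have {}neq : (if lead v == m then y else x) <> (if lead v == m then y' else x').
  by move=> e; apply: neq; rewrite e.
(* Each cell other than [L] contains a point whose [x] and [y] both equal its fixed bit. Two cells
   with the same [j] thus give [(0, 0, v)] and [(1, 1, v)], which mix to [(0, 1, v)] in [L]. *)
have Tv a b : T a b v -> ~~ (~~ a && b) ->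
  T (if lead v == m then b else a) (if lead v == m then b else a) v.
  move=> Tab abN; apply: T_cell Tab.
  rewrite /cell (negbTE abN) andNb /=; case: ifP => //.
have Tp' := Tv _ _ Tp pN.
have Tq' : T x' y' v.
  by apply: T_cell Tq; rewrite /cell -eqj.
have {}Tq' := Tv _ _ Tq' qN.
move: neq Tp' Tq'; set c := if _ then _ else x; set d := if _ then _ else _.
move=> cd Tc Td.
have TL : T false true v.
  by apply: (T_mix _ _ _ _ _ _ _ _ _ Tc Td); auto;
    move: cd; case: (c) (d) => -[]; auto.
exact: merge_None TL Tp pN.
Qed.

End Merge.

(** * The cells as words *)

Definition label := option ('I_m.+2 * bool).

(** Coordinates 0 and 1 are [x] and [y]; coordinate [k.+2] is bit [k] of [u]. For [j = m.+1] the
    case [k == j] never occurs, so [u] is all zeros. *)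
Definition cell_word (l : label) : word m.+3 :=
  [ffun i : 'I_m.+3 =>
    if l is Some (j, b) then
      match i : nat with
      | 0 => if j == m :> nat then if b then Some true else None else Some b
      | 1 => if j == m :> nat then Some b else if b then None else Some false
      | k.+2 => if k < j then Some false else if k == j then Some true else None
      end
    else match i : nat with 0 => Some false | 1 => Some true | _ => None end].

(** For [k > m] the index defaults to coordinate 0; [lead] never reads these values. *)
Definition tail (p : point m.+3) (k : nat) : bool := p (inord k.+2).

Definition point_label (p : point m.+3) : label :=
  omap (fun c : nat * bool => (inord c.1, c.2))
       (cell (p (inord 0)) (p (inord 1)) (tail p)).

Lemma in_cell_word (p : point m.+3) (l : label) :
  (p \in cube (cell_word l)) = (point_label p == l).
Proof.
have wordP (w : word m.+3) : reflect
    [/\ w (inord 0) = None \/ w (inord 0) = Some (p (inord 0)),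
        w (inord 1) = None \/ w (inord 1) = Some (p (inord 1)) &
        forall k, k <= m ->
          w (inord k.+2) = None \/ w (inord k.+2) = Some (tail p k)]
    (p \in cube w).
  rewrite inE; apply: (iffP forallP) => [wp|[w0 w1 wk] i].
    have wE i : w i = None \/ w i = Some (p i).
      by case/orP: (wp i) => /eqP; auto.
    by split.
  suff : w i = None \/ w i = Some (p i).
    by case=> ->; rewrite eqxx ?orbT.
  rewrite -(inord_val i); case: i => [[|[|k]] km] //=; exact: wk.
have tailP (j : 'I_m.+2) (b : bool) : (forall k, k <= m ->
      cell_word (Some (j, b)) (inord k.+2) = None \/
      cell_word (Some (j, b)) (inord k.+2) = Some (tail p k)) <->
    lead (tail p) = j.
  split=> [wk|jE k km].
    apply/eqP/leadP; split=> [|k kj|jm]; first by rewrite -ltnS.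
      have km : k <= m by rewrite -ltnS (leq_trans kj) // -ltnS.
      by have := wk k km; rewrite ffunE inordK //= kj => -[] // [].
    by have := wk j jm; rewrite ffunE inordK //= ltnn eqxx => -[] // [].
  have /leadP[_ jlt jj] : lead (tail p) == j by apply/eqP.
  rewrite ffunE inordK //=; have [kj|kj|kj] := ltngtP k j; first by rewrite jlt; auto.
    by left.
  by rewrite kj jj; [right | rewrite -kj].
(* Truth table: 11 and *0, as well as 1* and 00, split the three pairs other than [(0, 1)] according
   to the fixed bit. *)
have bitsP (e x y b : bool) :
    (let w := if e then if b then Some true else None else Some b in
       w = None \/ w = Some x) /\
    (let w := if e then Some b else if b then None else Some false in
       w = None \/ w = Some y) <->
    ~~ x && y = false /\ (if e then y else x) = b.
  by case: e; case: x; case: y; case: b => /=; intuition congruence.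
have lead_lt : lead (tail p) < m.+2.
  by have [] := leadP _ _ (eqxx (lead (tail p))).
apply/wordP/eqP; rewrite !ffunE !inordK //=.
  case: l => [[j b]|] [w0 w1 wk]; last first.
    case: w0 w1 => // -[p0] [] // [p1].
    by rewrite /point_label /cell -p0 -p1.
  have /tailP jE := wk; rewrite /point_label /cell jE.
  have [|-> /= ->] := (bitsP (j == m :> nat) (p (inord 0)) (p (inord 1)) b).1.
    by split.
  by rewrite inord_val.
rewrite /point_label /cell; case: ifP => [/andP[p0 p1] <-|p01 <-] /=.
  by split; [case: (p _) p0|rewrite p1|move=> k km; rewrite ffunE inordK]; auto.
have [w0 w1] := (bitsP (lead (tail p) == m) _ _ _).2 (conj p01 erefl).
by rewrite inordK //; split=> //; apply: (tailP _ _).2; rewrite inordK.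
Qed.

Definition mk_point (x y : bool) (v : nat -> bool) : point m.+3 :=
  [ffun i : 'I_m.+3 =>
    match i : nat with 0 => x | 1 => y | k.+2 => v k end].

Lemma cell_mk_point (x y : bool) (v : nat -> bool) :
  point_label (mk_point x y v) =
  omap (fun c : nat * bool => (inord c.1, c.2)) (cell x y v).
Proof.
have leadE : lead (tail (mk_point x y v)) = lead v.
  apply: eq_in_find => k; rewrite mem_iota /= => km.
  by rewrite /tail ffunE inordK.
by rewrite /point_label /cell leadE !ffunE !inordK.
Qed.

Lemma point_mk (p : point m.+3) :
  p = mk_point (p (inord 0)) (p (inord 1)) (tail p).
Proof.
apply/ffunP => i; rewrite ffunE -[i in LHS]inord_val.
by case: (nat_of_ord i) => [|[|k]].
Qed.

(** * Irreducibility, tightness and weights of the family *)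

Lemma family_irreducible : irreducible (cell_word @: {: label}).
Proof.
apply: (cells_irreducible _ _ _ _ in_cell_word) => s closed p q sp sq pq r.
pose T x y v := mk_point x y v \in cube s.
have Tp : T (p (inord 0)) (p (inord 1)) (tail p) by rewrite /T -point_mk.
have Tq : T (q (inord 0)) (q (inord 1)) (tail q) by rewrite /T -point_mk.
rewrite (point_mk r); apply: (merge_cells T _ _ _ _ _ _ _ _ Tp Tq).
- move=> x y v x' y' v' x'' y'' v'' T1 T2 hx hy hv.
  apply: cube_mix T1 T2 _ => i; rewrite !ffunE.
  by case: (nat_of_ord i) => [|[|k]].
- by move=> x y v x' y' v' e; apply: closed; rewrite !cell_mk_point e.
- by move=> e; apply: pq; rewrite /point_label e.
Qed.

Lemma family_tight : tight (cell_word @: {: label}).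
Proof.
move=> i; have [i2|i2] := ltnP i 2.
  exists (cell_word None); first exact: imset_f.
  by rewrite ffunE; case: (nat_of_ord i) i2 => [|[|k]].
(* Coordinate [k.+2] carries the first 1 of [u] in the cells with [k] leading zeros. *)
have j : i - 2 < m.+2 by have := ltn_ord i; lia.
exists (cell_word (Some (Ordinal j, true))); first exact: imset_f.
rewrite ffunE /=; case: (nat_of_ord i) i2 => [|[|k]] //= _.
by rewrite !subSS subn0 ltnn eqxx.
Qed.

(** The word of [u] contains a single 1, or none when [j = m.+1]; the bits [x], [y] add one for 1*,
    two for 11, and none for 00 and *0. *)
Lemma weight_cell (l : label) :
  weight (cell_word l) =
    if l is Some (j, b) then (j <= m) + (if b then (j == m :> nat).+1 else 0)
    else 1.
Proof.
have -> : weight (cell_word l) = \sum_i (cell_word l i == Some true).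
  by rewrite /weight -sum1dep_card big_mkcond.
rewrite 2!big_ord_recl !ffunE /=; case: l => [[j b]|]; last first.
  by rewrite big1 // => i _; rewrite ffunE.
rewrite addnA addnC; congr (_ + _); last by case: (_ == m); case: b.
transitivity (\sum_(i < m.+1) (i == j :> nat)).
  by apply: eq_bigr => i _; rewrite ffunE /=; case: ltngtP.
have [jm|jm] := leqP j m; last first.
  by rewrite big1 // => i _; rewrite ltn_eqF // (leq_trans _ jm).
rewrite (bigD1 (Ordinal (jm : j < m.+1))) //= eqxx big1 // => i.
by rewrite -val_eqE /= => /negbTE ->.
Qed.

(** Weight 0 comes from [(m.+1, false)]; weight 1 from [L], [(m.+1, true)] and the [m.+1] labels
    [(j, false)] with [j <= m]; weight 2 from [(j, true)] with [j < m]; weight 3 from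
    [(m, true)]. *)
Lemma family_weights :
  weight_vector (cell_word @: {: label}) = [:: 1; m.+3; m; 1] ++ nseq m 0 :> seq nat.
Proof.
apply: (@eq_from_nth _ 0) => [|h]; first by rewrite size_tuple /= size_nseq.
rewrite size_tuple => hm.
have := tnth_mktuple (fun h : 'I_m.+4 =>
  #|[set s in cell_word @: {: label} | weight s == h]|) (Ordinal hm).
rewrite (tnth_nth 0) /= => ->.
rewrite (card_cells_weight _ _ _ _ in_cell_word).
rewrite (bigD1 None) //= (reindex_omap Some id) => [|[]] //=.
have -> : \sum_(c | Some c == Some c :> label) (weight (cell_word (Some c)) == h) =
    \sum_(j < m.+2) \sum_b (weight (cell_word (Some (j, b))) == h).
  by rewrite pair_bigA; apply: eq_big => [c|[j b]] //=; rewrite eqxx.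
under eq_bigr do rewrite big_bool !weight_cell.
(* The terms [j = m.+1] and [j = m] are split off; the remaining [m] terms are all equal. *)
rewrite weight_cell !big_ord_recr /= leqnn eqxx ltnn (gtn_eqF (ltnSn m)) /=.
under eq_bigr => i _ do rewrite (ltnW (ltn_ord i)) (ltn_eqF (ltn_ord i)).
rewrite sum_nat_const card_ord.
case: h {hm} => [|[|[|[|h]]]] /=; rewrite ?nth_nseq ?if_same; lia.
Qed.

End Construction.

Theorem theorem2p32 (n : nat) (hn : 3 <= n) :
  exists F : {set word n},
    [/\ subcube_partition F,
        irreducible F,
        tight F &
        weight_vector F = [:: 1; n; n - 3; 1] ++ nseq (n - 3) 0 :> seq nat].
Proof.
case: n hn => [|[|[|m]]] // _; rewrite !subSS subn0.
exists (cell_word m @: {: label m}); split.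
- exact: cells_partition (in_cell_word m).
- exact: family_irreducible.
- exact: family_tight.
- exact: family_weights.
Qed.
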